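(* If $k\ge 3$ is odd then there exists a maximal $\mathcal{NAS}_k(2)$.
   Context: For a sequence $S=(s_i)_{i\ge0}$ with entries in $\mathbb{Z}_k$ write $\mathbf{s}_n(i)=(s_i,\dots,s_{i+n-1})$; an $n$-tuple occurs in $S$ if it equals $\mathbf{s}_n(i)$ for some $i$. A $k$-ary $n$-window sequence is a periodic sequence over $\mathbb{Z}_k$, of period $m$ say, such that $\mathbf{s}_n(i)=\mathbf{s}_n(j)$ implies $i\equiv j\pmod m$. For $k\ge3$, $n\ge2$, an $\mathcal{NAS}_k(n)$ ($k$-ary Negative Avoiding Sequence of span $n$) is a $k$-ary $n$-window sequence $S$ such that whenever an $n$-tuple $\mathbf{a}=(a_0,\dots,a_{n-1})$ occurs in $S$, its negative $-\mathbf{a}=(-a_0,\dots,-a_{n-1})$ does not occur in $S$. An $\mathcal{NAS}_k(n)$ is maximal if its period equals $\frac{k^n-1}{2}$ when $k$ is odd, or $\frac{k^n-2^n}{2}$ when $k$ is even. *)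

(* Defs.v *)
From HB Require Import structures.
From mathcomp Require Import all_boot all_order all_algebra.
Set Implicit Arguments. Unset Strict Implicit. Unset Printing Implicit Defensive.
Import GRing.Theory.
Local Open Scope ring_scope.

(* 'Z_k is the ring of integers modulo k only for k > 1; these notions are
   meant to be used with k >= 3 and n >= 2. *)

Definition window (k n : nat) (S : nat -> 'Z_k) (i : nat) : n.-tuple 'Z_k :=
  [tuple S (i + j)%N | j < n].

Definition occurs (k n : nat) (S : nat -> 'Z_k) (a : n.-tuple 'Z_k) : Prop :=
  exists i : nat, window n S i = a.

Definition neg_tuple (k n : nat) (a : n.-tuple 'Z_k) : n.-tuple 'Z_k :=
  [tuple - tnth a j | j < n].

Definition has_period (k : nat) (S : nat -> 'Z_k) (m : nat) : Prop :=
  (0 < m)%N /\ forall i : nat, S (i + m)%N = S i.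

(* The second clause forces m to be the least period of S: if m' is any
   period, the windows at 0 and m' agree, so m divides m'. *)
Definition window_sequence (k n m : nat) (S : nat -> 'Z_k) : Prop :=
  has_period S m /\
  forall i j : nat, window n S i = window n S j -> i = j %[mod m].

Definition NAS (k n m : nat) (S : nat -> 'Z_k) : Prop :=
  window_sequence n m S /\
  forall a : n.-tuple 'Z_k, occurs S a -> ~ occurs S (neg_tuple a).

(* Both divisions by 2 are exact. *)
Definition max_period (k n : nat) : nat :=
  if odd k then ((k ^ n - 1) %/ 2)%N else ((k ^ n - 2 ^ n) %/ 2)%N.

Definition maximal_NAS (k n : nat) (S : nat -> 'Z_k) : Prop :=
  exists m : nat, NAS n m S /\ m = max_period k n.

(* Main.v *)
Require Import Defs.
From mathcomp Require Import all_boot all_order all_algebra.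
From mathcomp Require Import zify.

Set Implicit Arguments.
Unset Strict Implicit.
Unset Printing Implicit Defensive.

Import GRing.Theory.

(** Identify 'Z_k with the integers between -t and t, where k = 2t+1.  For each
    u = 1, ..., t the closed walk
      0 -> u -> u -> 1 -> u -> -1 -> u -> ... -> u-1 -> u -> -(u-1) -> u -> -u -> 0
    has length 4u and uses, up to negation, every pair whose larger absolute
    value is u.  Concatenating these walks gives a closed walk of length
    m = 2t(t+1) = (k^2-1)/2 whose steps and their negatives cover all k^2-1
    nonzero pairs; since there are only 2m of them, no repetition occurs. *)

(** The induction step for locating pieces inside a concatenation: the vertex [c] that closes one
    piece is the first vertex of the next. *)
Lemma infix_rcons_cat (T : eqType) (s s' : seq T) (c d : T) :
  infix (rcons s c) (rcons (s ++ c :: s') d).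
Proof. by rewrite rcons_cat rcons_cons -cat_rcons prefix_infix. Qed.

Section Walk.
Local Open Scope ring_scope.
Variable R : nzRingType.

(** Each list of the construction omits its final vertex, because the piece that follows begins with
    it. This is why the lemmas below close the lists with [rcons]. *)
Fixpoint spokes (u n : nat) : seq R :=
  if n is x.+1 then spokes u x ++ [:: u%:R; x.+1%:R; u%:R; - x.+1%:R] else [::].

Definition block (u : nat) : seq R :=
  [:: 0; u%:R] ++ spokes u u.-1 ++ [:: u%:R; - u%:R].

Fixpoint walk (t : nat) : seq R :=
  if t is u.+1 then walk u ++ block u.+1 else [::].

Lemma size_walk t : size (walk t) = (2 * t * t.+1)%N.
Proof.
have size_spokes u n : size (spokes u n) = (4 * n)%N.
  by elim: n => //= n IHn; rewrite size_cat IHn /=; lia.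
by elim: t => // t IHt; rewrite /= size_cat IHt /= size_cat size_spokes /=; lia.
Qed.

Lemma infix_spokes u x n : (0 < x <= n)%N ->
  infix [:: u%:R; x%:R; u%:R; - x%:R; u%:R] (rcons (spokes u n) u%:R).
Proof.
elim: n => [|n IHn] /andP[x_gt0]; first by case: x x_gt0.
rewrite leq_eqVlt => /predU1P[->|x_le_n].
  by rewrite /= rcons_cat suffix_infix.
apply: infix_trans (IHn _) (infix_rcons_cat _ _ _ _).
by rewrite x_gt0.
Qed.

Lemma infix_block t w : (0 < w <= t)%N ->
  infix (rcons (block w) 0) (rcons (walk t) 0).
Proof.
elim: t => [|t IHt] /andP[w_gt0]; first by case: w w_gt0.
rewrite leq_eqVlt => /predU1P[->|w_le_t].
  by rewrite [walk _]/= rcons_cat suffix_infix.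
apply: infix_trans (IHt _) (infix_rcons_cat _ _ _ _).
by rewrite w_gt0.
Qed.

Lemma block_ends w : infix [:: w%:R; - w%:R; 0] (rcons (block w) 0) /\
  infix [:: 0; w%:R; w%:R] (rcons (block w) 0).
Proof.
split; first by rewrite /block !rcons_cat catA suffix_infix.
(* The second [w] of the block opens the first spoke, or the tail of the block if there are no
   spokes. The list [l] is general because [spokes] grows on the right. *)
have spokes_head n l : prefix [:: w%:R] l -> prefix [:: w%:R] (spokes w n ++ l).
  by elim: n l => //= n IHn l _; rewrite -catA IHn //= eqxx.
apply: prefixW; rewrite /block !rcons_cat /= !eqxx /=.
by apply: spokes_head; rewrite /= eqxx.
Qed.

Lemma block_spokes w x : (0 < x < w)%N ->
  infix [:: w%:R; x%:R; w%:R; - x%:R; w%:R] (rcons (block w) 0).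
Proof.
move=> x_bnd; apply: infix_trans (infix_spokes w (n := w.-1) _) _; first by lia.
by rewrite /block -cat_rcons !rcons_cat infix_catl // prefix_infix.
Qed.

Definition up_to_sign (a b : R) (s : seq R) : bool :=
  infix [:: a; b] s || infix [:: - a; - b] s.

Lemma up_to_signN a b s : up_to_sign (- a) (- b) s = up_to_sign a b s.
Proof. by rewrite /up_to_sign !opprK orbC. Qed.

(** Block [w] supplies the pairs: its two ends if [x] is 0 or [w], the spoke of [x] otherwise. At
    the ends, (w, 0) and (-w, w) are obtained as the negatives of (-w, 0) and (w, -w). *)
Lemma walk_cover_max t w x : (0 < w <= t)%N -> (x <= w)%N ->
  let s := rcons (walk t) 0 in
  [/\ up_to_sign w%:R x%:R s, up_to_sign x%:R w%:R s,
      up_to_sign w%:R (- x%:R) s & up_to_sign (- x%:R) w%:R s].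
Proof.
move=> w_bnd x_le s; have blk := infix_block w_bnd.
have [blk_e blk_s] := block_ends w.
have sub l1 l2 (a b : R) : infix (l1 ++ [:: a; b] ++ l2) (rcons (block w) 0) ->
    up_to_sign a b s.
  move=> l_blk; apply/orP; left; apply: infix_trans blk.
  apply: infix_trans l_blk; exact: infix_infix.
have subN l1 l2 (a b : R) :
    infix (l1 ++ [:: a; b] ++ l2) (rcons (block w) 0) -> up_to_sign (- a) (- b) s.
  by move=> /sub; rewrite up_to_signN.
case: (posnP x) => [->|x_gt0].
  rewrite mulr0n oppr0.
  have w0 : up_to_sign w%:R 0 s.
    by rewrite -up_to_signN oppr0; apply: (sub [:: w%:R] [::]).
  have w1 : up_to_sign 0 w%:R s by apply: (sub [::] [:: w%:R]).
  by split.
move: x_le; rewrite leq_eqVlt => /predU1P[->|x_lt].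
  split.
  - exact: (sub [:: 0] [::]).
  - exact: (sub [:: 0] [::]).
  - exact: (sub [::] [:: 0]).
  - by rewrite -{2}(opprK w%:R); apply: (subN [::] [:: 0]).
have := @block_spokes w x; rewrite x_gt0 => /(_ x_lt) sp; split.
- exact: (sub [::] [:: _; _; _] _ _ sp).
- exact: (sub [:: _] [:: _; _] _ _ sp).
- exact: (sub [:: _; _] [:: _] _ _ sp).
- exact: (sub [:: _; _; _] [::] _ _ sp).
Qed.

(** Negating the whole pair if necessary makes the sign of the larger of [u] and [v] positive, which
    leaves the pairs of [walk_cover_max]. *)
Lemma walk_cover t u v (e1 e2 : bool) :
  (u <= t)%N -> (v <= t)%N -> (0 < maxn u v)%N ->
  up_to_sign ((-1) ^+ e1 * u%:R) ((-1) ^+ e2 * v%:R) (rcons (walk t) 0).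
Proof.
move=> u_le v_le uv_gt0; case: (leqP u v) => [uv | /ltnW vu].
  have v_bnd : (0 < v <= t)%N by move: uv_gt0; rewrite (maxn_idPr uv) v_le andbT.
  have [_ c1 _ c2] := walk_cover_max v_bnd uv.
  by case: e1 e2 => [] []; rewrite ?mulN1r ?mul1r ?up_to_signN // -up_to_signN opprK.
have u_bnd : (0 < u <= t)%N by move: uv_gt0; rewrite (maxn_idPl vu) u_le andbT.
have [c1 _ c2 _] := walk_cover_max u_bnd vu.
by case: e1 e2 => [] []; rewrite ?mulN1r ?mul1r ?up_to_signN // -up_to_signN opprK.
Qed.

Lemma nth0_walk t : nth 0 (walk t) 0 = 0.
Proof. by elim: t => // t IHt; rewrite /= nth_cat; case: ifP. Qed.

Definition cyclic_walk t (i : nat) : R := nth 0 (walk t) (i %% size (walk t)).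

Lemma cyclic_walk_infix t a b : infix [:: a; b] (rcons (walk t) 0) ->
  exists2 i, (i < size (walk t))%N & cyclic_walk t i = a /\ cyclic_walk t i.+1 = b.
Proof.
case/infixP=> p [q def_w]; have := congr1 size def_w.
rewrite size_rcons !size_cat /= => sz_w.
have i_lt : (size p < size (walk t))%N by rewrite -ltnS sz_w !addnS !ltnS leq_addr.
exists (size p) => //; split.
  have := congr1 (nth 0 ^~ (size p)) def_w.
  by rewrite nth_rcons i_lt nth_cat ltnn subnn /cyclic_walk modn_small.
have := congr1 (nth 0 ^~ (size p).+1) def_w.
(* The appended vertex and the default value of [nth] are both 0, so [if_same] merges the two cases
   past the end of the walk. *)
rewrite nth_rcons if_same nth_cat (ltnNge _ (size p)) leqW // subSn // subnn /= /cyclic_walk.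
(* Either the pair lies inside the walk, or its second entry is the closing 0, which the cyclic
   reading finds again at index 0. *)
have [i1_lt <-|i1_ge] := ltnP; first by rewrite modn_small.
have -> : (size p).+1 = size (walk t) by apply/eqP; rewrite eqn_leq i_lt.
by rewrite modnn nth0_walk.
Qed.

End Walk.

Lemma Zp_sign_nat (k : nat) (a : 'Z_k) : (1 < k)%N -> odd k ->
  exists (e : bool) (u : nat), (u <= k./2)%N /\ a = ((-1) ^+ e * u%:R)%R.
Proof.
move=> k_gt1 k_odd; have a_lt : (a < k)%N by rewrite -[X in (_ < X)%N](Zp_cast k_gt1).
have [a_le|a_gt] := leqP a k./2.
  by exists false, a; rewrite mul1r natr_Zp.
exists true, (k - a)%N; split; first by lia.
by rewrite mulN1r natrB 1?ltnW // pchar_Zp // sub0r opprK natr_Zp.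
Qed.

(** Injectivity on signed positions serves both requirements: equal signs give the window property,
    opposite signs exclude negatives. *)
Lemma cyclic_walk_inj (k : nat) (i j : nat) (e1 e2 : bool) :
  (1 < k)%N -> odd k ->
  let S := @cyclic_walk 'Z_k k./2 in
  ((-1) ^+ e1 * S i = (-1) ^+ e2 * S j)%R ->
  ((-1) ^+ e1 * S i.+1 = (-1) ^+ e2 * S j.+1)%R ->
  i = j %[mod size (walk 'Z_k k./2)] /\ e1 = e2.
Proof.
move=> k_gt1 k_odd S; set m := size _ => eq0 eq1.
have m_gt0 : (0 < m)%N by rewrite /m size_walk; lia.
pose f (x : 'I_m * bool) : 'Z_k * 'Z_k :=
  ((-1) ^+ x.2 * S x.1, (-1) ^+ x.2 * S x.1.+1)%R.
have cover : [set~ (0, 0)%R] \subset f @: setT.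
  apply/subsetP=> -[a b]; rewrite !inE => ab_neq0.
  have [e [u [u_le def_a]]] := Zp_sign_nat a k_gt1 k_odd.
  have [e' [v [v_le def_b]]] := Zp_sign_nat b k_gt1 k_odd.
  have uv_gt0 : (0 < maxn u v)%N.
    rewrite lt0n; apply: contraNneq ab_neq0 => /eqP; rewrite -leqn0 geq_max !leqn0.
    by case/andP=> /eqP u0 /eqP v0; rewrite def_a def_b u0 v0 !mulr0.
  have := @walk_cover 'Z_k k./2 u v e e' u_le v_le uv_gt0; rewrite -def_a -def_b.
  case/orP=> /cyclic_walk_infix[l l_lt [Sl Sl1]]; apply/imsetP.
    by exists (Ordinal l_lt, false); rewrite ?inE // /f /= !mul1r /S Sl Sl1.
  by exists (Ordinal l_lt, true); rewrite ?inE // /f /= !mulN1r /S Sl Sl1 !opprK.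
(* The image has at least k^2 - 1 elements by [cover], and the domain has exactly 2m = k^2 - 1. *)
have f_inj : injective f.
  have /imset_injP f_injT : #|f @: setT| == #|[set: 'I_m * bool]|.
    rewrite eqn_leq leq_imset_card /=; apply: leq_trans (subset_leq_card cover).
    rewrite cardsC1 card_prod !card_ord cardsT card_prod card_ord card_bool.
    rewrite Zp_cast // /m size_walk.
    have := odd_double_half k; rewrite k_odd; nia.
  by move=> x y; apply: f_injT; rewrite inE.
have SM l : S (l %% m) = S l by rewrite /S /cyclic_walk modn_mod.
have SM1 l : S (l %% m).+1 = S l.+1.
  by rewrite /S /cyclic_walk -/m -[(l %% m).+1]addn1 modnDml addn1.
have mod_lt l : (l %% m < m)%N by rewrite ltn_mod.
have := @f_inj (Ordinal (mod_lt i), e1) (Ordinal (mod_lt j), e2).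
by rewrite /f /= !SM !SM1 eq0 eq1 => /(_ erefl) [].
Qed.

Theorem theorem6p2 (k : nat) (hk : 3 <= k) (hodd : odd k) :
  exists S : nat -> 'Z_k, maximal_NAS 2 S.
Proof.
have k_gt1 : 1 < k by exact: ltnW.
pose S := @cyclic_walk 'Z_k k./2; pose m := size (walk 'Z_k k./2).
have winE i l : tnth (window 2 S i) l = S (i + l) by rewrite tnth_mktuple.
exists S, m; split; last first.
  rewrite /m size_walk /max_period hodd.
  have := odd_double_half k; rewrite hodd => k_half.
  have -> : k ^ 2 - 1 = 2 * k./2 * (k./2).+1 * 2 by nia.
  by rewrite mulnK.
split; [split; [split|]|].
- by rewrite /m size_walk; lia.
- by move=> i; rewrite /S /cyclic_walk modnDr.
- move=> i j eq_win.
  have eqS (l : 'I_2) : S (i + l) = S (j + l) by rewrite -!winE eq_win.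
  have [||//] := @cyclic_walk_inj k i j false false k_gt1 hodd.
    by congr (_ * _)%R; have := eqS ord0; rewrite !addn0.
  by congr (_ * _)%R; have := eqS ord_max; rewrite !addn1.
- move=> a [i <-] [j eq_win].
  have eqS (l : 'I_2) : S (j + l) = (- S (i + l)%N)%R.
    by rewrite -!winE eq_win tnth_mktuple.
  (* A window equal to the negative of another would force the two signs to agree, that is
     [false = true]. *)
  have [||//] := @cyclic_walk_inj k j i false true k_gt1 hodd.
    by rewrite expr0 expr1 mul1r mulN1r; have := eqS ord0; rewrite !addn0.
  by rewrite expr0 expr1 mul1r mulN1r; have := eqS ord_max; rewrite !addn1.
Qed.
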